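(* Let $m$ be a positive integer and let $\varepsilon$ be a real number with $\frac{m-2}{m}\le\varepsilon<\frac{m-1}{m}$. For any power of two $q$ there exists an $n^{\varepsilon}$-batch code over $\mathbb{F}_q$ of length $N=q^m$ and dimension $n$ such that the redundancy $N-n$ satisfies $$N-n=O\left(n^{(m-\log\lambda_m)\varepsilon+\left((m-1)\log\lambda_m/m-m+2\right)}\right),$$ where the asymptotics are as $q\to\infty$ with $m,\varepsilon$ fixed.
   Context: $\log$ is the logarithm in base two. $\mathbb{F}_q$ is the field with $q$ elements and $[n]=\{1,\dots,n\}$. Batch code. Let $F:\mathbb{F}_q^n\to\mathbb{F}_q^N$ be an encoding map (injective) sending $(x_1,\dots,x_n)$ to $(y_1,\dots,y_N)$ and let $\mathcal{C}$ be the image of $F$. The code $\mathcal{C}$ (with length $N$ and dimension $n$) is a $k$-batch code if for every multiset of message symbols $\{x_{i_1},\dots,x_{i_k}\}$, $i_j\in[n]$, there exist $k$ mutually disjoint sets $R_1,\dots,R_k\subset[N]$ and functions $g_1,\dots,g_k$ such that for all $\mathbf y=F(x_1,\dots,x_n)\in\mathcal{C}$ and all $j\in[k]$, $g_j(\mathbf y|_{R_j})=x_{i_j}$, where $\mathbf y|_R$ is the projection of $\mathbf y$ onto the coordinates in $R$. If $k>0$ is not an integer, ''$k$-batch'' means $\lceil k\rceil$-batch. The number $\lambda_m$. Let $A_m$ be the $m\times m$ matrix with rows and columns indexed by $0,1,\dots,m-1$ whose entry in row $j$ and column $0$ is $\binom{m}{\ge 2j+1}$ and whose entry in row $j$ and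 column $c\ge 1$ is $\binom{m}{2j+1-c}$. Here $\binom{b}{\ge a}$ is the number of subsets with at least $a$ elements of a $b$-element set, and $\binom{b}{a}=0$ if $a<0$ or $a>b$. Then $\lambda_m$ is the largest eigenvalue of $A_m$ ($A_m$ is entrywise non-negative, so this is its spectral radius). *)

(* Defs.v *)
From HB Require Import structures.
From mathcomp Require Import all_boot all_order all_algebra.
Set Implicit Arguments.
Unset Strict Implicit.
Unset Printing Implicit Defensive.
Import Order.TTheory GRing.Theory Num.Theory.
Local Open Scope ring_scope.

Definition proj (F : Type) (N : nat) (Q : {set 'I_N}) (y : 'rV[F]_N) :
    {ffun {i : 'I_N | i \in Q} -> F} :=
  [ffun i => y ord0 (val i)].

(* The requested multiset of message symbols is listed by u, with repetitions.
   The number n of message symbols is the dimension of the code; E need not be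
   linear. *)
Definition is_batch_code (F : Type) (n N : nat) (E : 'rV[F]_n -> 'rV[F]_N)
    (k : nat) : Prop :=
  injective E /\
  forall u : 'I_k -> 'I_n,
    exists (Q : 'I_k -> {set 'I_N})
           (g : forall j : 'I_k, {ffun {i : 'I_N | i \in Q j} -> F} -> F),
      (forall j1 j2 : 'I_k, j1 != j2 -> [disjoint Q j1 & Q j2]) /\
      (forall (x : 'rV[F]_n) (j : 'I_k), g j (proj (Q j) (E x)) = x ord0 (u j)).

Definition binom_ge (b a : nat) : nat :=
  #|[set S : {set 'I_b} | (a <= #|S|)%N]|.

(* The test on c is needed because subtraction on nat is truncated. *)
Definition Amat (R : pzRingType) (m : nat) : 'M[R]_m :=
  \matrix_(j < m, c < m)
    (if c == 0%N :> nat then binom_ge m (2 * j + 1)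
     else if (c <= 2 * j + 1)%N then 'C(m, 2 * j + 1 - c) else 0%N)%:R.

Lemma eigenvalue_Amat1 (R : fieldType) (m : nat) :
  (0 < m)%N -> eigenvalue (Amat R m) 1.
Proof.
case: m => // m _; apply/eigenvalueP; exists (delta_mx 0 ord_max); last first.
  by apply/eqP => /matrixP/(_ 0 ord_max); rewrite !mxE !eqxx => /eqP; rewrite oner_eq0.
rewrite scale1r -rowE; apply/rowP => c; rewrite !mxE /=.
have lt_c := ltn_ord c; rewrite -(inj_eq val_inj) /=.
case: eqP => [c0|/eqP cn0].
  case: (posnP m) => [m0|m_gt0].
    rewrite c0; move: m0 c {lt_c c0} => -> c; rewrite eqxx /binom_ge.
    rewrite (eq_card (B := pred1 [set: 'I_1])) ?card1// => S.
    by rewrite !inE muln0 add0n eqEcard subsetT/= cardsT card_ord.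
  rewrite c0 (ltn_eqF m_gt0) /binom_ge eq_card0// => S; rewrite !inE.
  apply/negbTE; rewrite -ltnNge (leq_ltn_trans (max_card _))// card_ord.
  by rewrite mul2n -addnn addn1 ltnS -[X in (X < _)%N]addn0 ltn_add2l.
case: ifP => [_|/negbT]; last first.
  rewrite -ltnNge => h; exfalso; move: h; apply/negP; rewrite -leqNgt.
  by rewrite (leq_trans (ltnW lt_c))// addn1 ltnS leq_pmull.
case: (ltngtP c m) => [cm|mc|->].
- rewrite bin_small ?mulr0n//= mul2n -addnn addn1 -addnS.
  by rewrite addnC -addnBA ?(ltnW cm)// -[X in (X < _)%N]addn0 ltn_add2l subn_gt0.
- by move: lt_c; rewrite ltnS leqNgt mc.
- by rewrite mul2n -addnn addn1 -addnS addnC addnK binn.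
Qed.

From mathcomp Require Import all_classical all_reals all_analysis.
Import numFieldNormedType.Exports.
Local Open Scope classical_set_scope.

Definition log2 (R : realType) (x : R) : R := ln x / ln 2.

Definition is_batch_code_real (R : realType) (F : Type) (n N : nat)
    (E : 'rV[F]_n -> 'rV[F]_N) (k : R) : Prop :=
  is_batch_code E `|Num.ceil k|%N.

(* This supremum is a maximum when 0 < m: see lambdaP. *)
Definition lambda (R : realType) (m : nat) : R :=
  sup [set a : R | eigenvalue (Amat R m) a].

Lemma max_root (R : realDomainType) (p : {poly R}) (a : R) :
  p != 0 -> root p a -> exists2 b, root p b & forall c, root p c -> c <= b.
Proof.
have [k] := ubnP (size p); elim: k p a => // k IH p a.
rewrite ltnS => sp p0 /factor_theorem[q pE].
have q0 : q != 0 by apply: contraNneq p0 => q0; rewrite pE q0 mul0r.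
have rp x : root p x = root q x || (x == a) by rewrite pE rootM root_XsubC.
have sq : (size q < k)%N.
  by move: sp; rewrite pE size_Mmonic ?monicXsubC// size_XsubC addn2.
have [[c qc]|noc] := pselect (exists c, root q c); last first.
  exists a => [|c]; first by rewrite rp eqxx orbT.
  by rewrite rp => /orP[qc|/eqP->//]; exfalso; apply: noc; exists c.
have [b qb bmax] := IH q c sq q0 qc.
have [ab|ba] := leP a b.
  by exists b => [|d]; rewrite rp ?qb// => /orP[/bmax//|/eqP->].
exists a => [|d]; rewrite rp ?eqxx ?orbT// => /orP[/bmax db|/eqP->//].
exact: le_trans db (ltW ba).
Qed.

Lemma lambdaP (R : realType) (m : nat) : (0 < m)%N ->
  eigenvalue (Amat R m) (lambda R m) /\
  forall a : R, eigenvalue (Amat R m) a -> a <= lambda R m.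
Proof.
move=> m_gt0; have p0 : char_poly (Amat R m) != 0.
  by rewrite monic_neq0// char_poly_monic.
have := eigenvalue_Amat1 R m_gt0; rewrite eigenvalue_root_char.
case/(max_root p0) => b pb bmax.
have bub a : eigenvalue (Amat R m) a -> a <= b.
  by rewrite eigenvalue_root_char => /bmax.
suff -> : lambda R m = b by rewrite eigenvalue_root_char.
apply/eqP; rewrite eq_le; apply/andP; split.
  by apply: ge_sup => //; exists b; rewrite /= eigenvalue_root_char.
by apply: ub_le_sup; [exists b | rewrite /= eigenvalue_root_char].
Qed.

(* Main.v *)
(* Take [a = m * eps - m + 2] in [0, 1), [q = 2 ^ l] and [r = 2 ^ s] with [s] the
   ceiling of [l * a].  The code is spanned by the evaluations on F_q^m of the
   monomials whose restriction to every line is a polynomial of degree less than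
   [q - r], so that a symbol can be recovered from any [q - r] other points of
   any line through it.  Since the lines through a point partition the remaining
   points, an averaging argument lets a greedy choice of lines serve about
   [r * q ^ (m - 2)] requests with disjoint recovery sets.

   In characteristic 2, a monomial [x ^ d] fails to qualify only if some [e] with
   [e i] a binary submask of each [d i] has a sum that is congruent modulo
   [q - 1] to a number with its [l - s] upper bits all equal to 1.  Performing
   this addition from the top bit downwards, the smallest possible carry is
   governed by the transition matrix [Amat], so there are at most
   [2 ^ (m * s)] times a constant times [lambda ^ (l - s)] bad monomials.  The
   bound without polynomial factor comes from a positive eigenvector of an
   irreducible block of [Amat] (Perron-Frobenius). *)
Require Import Defs.
From HB Require Import structures.
From mathcomp Require Import all_boot all_order all_algebra all_field.
From mathcomp Require Import zify ring lra.
Set Implicit Arguments.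
Unset Strict Implicit.
Unset Printing Implicit Defensive.
Import Order.TTheory GRing.Theory Num.Theory.

(** * Carries in binary addition *)

(** Lucas' theorem at the prime 2 for a single binary digit, by Pascal's rule. *)
Lemma odd_bin_double (n k : nat) :
  [/\ odd 'C(n.*2, k.*2) = odd 'C(n, k), odd 'C(n.*2, k.*2.+1) = false,
      odd 'C(n.*2.+1, k.*2) = odd 'C(n, k) &
      odd 'C(n.*2.+1, k.*2.+1) = odd 'C(n, k)].
Proof.
elim: n k => [|n IH] k; first by case: k.
have even_row j : odd 'C(n.+1.*2, j.*2) = odd 'C(n.+1, j).
  case: j => [|j]; first by rewrite !bin0.
  have [_ _ _ h1] := IH j; have [_ _ h2 _] := IH j.+1.
  by rewrite !doubleS binS oddD -doubleS h2 h1 binS oddD.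
have odd_row j : odd 'C(n.+1.*2, j.*2.+1) = false.
  have [_ _ h1 h2] := IH j.
  by rewrite doubleS binS oddD h1 h2 addbb.
split=> //; last by rewrite binS oddD even_row odd_row.
case: k => [|k]; first by rewrite !bin0.
by rewrite [k.+1.*2]doubleS binS oddD -doubleS even_row odd_row addbF.
Qed.

Lemma odd_bin_half (n k : nat) :
  odd 'C(n, k) = (odd k ==> odd n) && odd 'C(n./2, k./2).
Proof.
have [h1 h2 h3 h4] := odd_bin_double n./2 k./2.
rewrite -[n in LHS]odd_double_half -[k in LHS]odd_double_half.
by case: (odd n); case: (odd k); rewrite ?add0n ?add1n ?h1 ?h2 ?h3 ?h4.
Qed.

Lemma odd_bin_top (T a b d e : nat) : d < 2 ^ T -> e < 2 ^ T ->
  odd 'C(a * 2 ^ T + d, b * 2 ^ T + e) = odd 'C(a, b) && odd 'C(d, e).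
Proof.
elim: T d e => [|T IH] d e.
  by rewrite expn0 !ltnS !leqn0 => /eqP-> /eqP->; rewrite !muln1 !addn0 andbT.
rewrite !expnS => d_lt e_lt.
rewrite odd_bin_half [in RHS](odd_bin_half d e).
have oddE c f : odd (c * (2 * 2 ^ T) + f) = odd f by lia.
have halfE c f : (c * (2 * 2 ^ T) + f)./2 = c * 2 ^ T + f./2 by lia.
by rewrite !oddE !halfE IH; [rewrite andbCA | lia | lia].
Qed.

(** The exponent of [X ^ k] reduced modulo [X ^ q - X]. Zero is kept apart because [x ^ 0] and
    [x ^ (q - 1)] differ at [x = 0]. *)
Definition reduced_exponent (q k : nat) : nat :=
  if k == 0 then 0 else (k.-1 %% q.-1).+1.

(** By Lucas' theorem this is bitwise inclusion. The parity of the binomial is the form in which it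
    occurs, as a coefficient of [(a + t b) ^ d] in characteristic 2. *)
Definition submask (m q : nat) (d e : {ffun 'I_m -> 'I_q}) : bool :=
  [forall i, odd 'C(d i, e i)].

Definition good_exponent (m q r : nat) (d : {ffun 'I_m -> 'I_q}) : bool :=
  [forall e : {ffun 'I_m -> 'I_q},
     submask d e ==> (reduced_exponent q (\sum_i e i) < q - r)].

(** [2 * j + 1 - #|S|] is the least carry into a position with sum bit 1 and outgoing carry at least
    [j], when only the summands in [S] may have bit 1 there; truncation at 0 is intended. The count
    thus runs over the possible top [t] bits of an exponent, one set [S] per position. *)
Fixpoint carry_count (m t j : nat) : nat :=
  if t is t'.+1 then
    \sum_(S : {set 'I_m} | 2 * j + 1 - #|S| < m)
      carry_count m t' (2 * j + 1 - #|S|)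
  else 1.

(* Adding the numbers [e i] and a carry [w], the bits of the sum in positions
   [s, .., T - 1] are all equal to 1 and the carry out of position [T - 1] is
   [j0]. *)
Definition carries (m s T j : nat) (d : {ffun 'I_m -> 'I_(2 ^ T)}) : bool :=
  [exists e : {ffun 'I_m -> 'I_(2 ^ T)}, exists j0 : 'I_m, exists w : 'I_m,
     [&& submask d e, j <= j0, j0.+1 * 2 ^ T <= \sum_i e i + w + 2 ^ s &
         \sum_i e i + w < j0.+1 * 2 ^ T]].

Section TopBit.
Variables (m T : nat).
Implicit Type d : {ffun 'I_m -> 'I_(2 ^ T.+1)}.

Definition top_bits d : {set 'I_m} := [set i | 2 ^ T <= d i].

Lemma low_bits_subproof d i : d i %% 2 ^ T < 2 ^ T.
Proof. by rewrite ltn_pmod // expn_gt0. Qed.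

Definition low_bits d : {ffun 'I_m -> 'I_(2 ^ T)} :=
  [ffun i => Ordinal (low_bits_subproof d i)].

Lemma top_low_bits d i : d i = (i \in top_bits d) * 2 ^ T + low_bits d i :> nat.
Proof.
rewrite inE ffunE /=; have d_lt : d i < 2 * 2 ^ T by rewrite -expnS.
case: leqP => /= h; last by rewrite modn_small.
by rewrite -[X in X %% _](subnK h) modnDr modn_small //; lia.
Qed.

Lemma top_low_bits_inj : injective (fun d => (top_bits d, low_bits d)).
Proof.
move=> d1 d2 [eqt eql]; apply/ffunP => i; apply: val_inj => /=.
by rewrite !top_low_bits eqt eql.
Qed.

Lemma sum_top_low_bits d :
  \sum_i d i = #|top_bits d| * 2 ^ T + \sum_i low_bits d i.
Proof.
rewrite (eq_bigr _ (fun i _ => top_low_bits d i)) big_split /=; congr addn.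
by rewrite -big_distrl /= -sum1_card [in RHS]big_mkcond; congr muln.
Qed.

Lemma submask_top_low d (e : {ffun 'I_m -> 'I_(2 ^ T.+1)}) : submask d e ->
  (top_bits e \subset top_bits d) /\ submask (low_bits d) (low_bits e).
Proof.
move=> /forallP sub; have sub' i :
    odd 'C(i \in top_bits d, i \in top_bits e) && odd 'C(low_bits d i, low_bits e i).
  by rewrite -(@odd_bin_top T) ?ltn_ord // -!top_low_bits sub.
split; last by apply/forallP => i; have /andP[] := sub' i.
apply/subsetP => i ie; have /andP[+ _] := sub' i.
by rewrite ie; case: (i \in top_bits d).
Qed.

End TopBit.

(** If [h] summands have their top bit set, sum bit 1 and outgoing carry [j0] force the incoming
    carry [2 * j0 + 1 - h]. Since [j <= j0] and [h] is at most the number of top bits of [d], this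
    is at least the stated lower bound. *)
Lemma carries_low (m s T j : nat) (d : {ffun 'I_m -> 'I_(2 ^ T.+1)}) :
  s <= T -> carries s j d ->
  (2 * j + 1 - #|top_bits d| < m) &&
  carries s (2 * j + 1 - #|top_bits d|) (low_bits d).
Proof.
move=> sT /existsP[e /existsP[j0 /existsP[w /and4P[de jj0 lo hi]]]].
have [/subset_leq_card card_top sub_low] := submask_top_low de.
move: lo hi; rewrite sum_top_low_bits => lo hi; have TE := expnS 2 T.
set h := #|top_bits e| in card_top lo hi; set h' := #|top_bits d| in card_top *.
set sg := \sum_i low_bits e i in lo hi.
have pT : 0 < 2 ^ T by rewrite expn_gt0.
have ps : 2 ^ s <= 2 ^ T by rewrite leq_pexp2l.
have sg_le : sg <= m * (2 ^ T).-1.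
  rewrite /sg -[X in X * _]card_ord -sum_nat_const; apply: leq_sum => i _.
  by have := ltn_ord (low_bits e i); lia.
have w_lt := ltn_ord w.
(* The upper bound on the sum gives [h <= 2 * j0 + 1], so the subtraction is not truncated. *)
have j1E : (2 * j0 + 1 - h).+1 = 2 * j0 + 2 - h.
  suff : h <= 2 * j0 + 1 by lia.
  have : h * 2 ^ T < (2 * j0 + 2) * 2 ^ T by nia.
  by rewrite ltn_pmul2r //; lia.
(* The low parts, [w < m] and [2 ^ s <= 2 ^ T] add up to less than [(m + 1) * 2 ^ T]. *)
have j1_lt : 2 * j0 + 1 - h < m.
  suff : (2 * j0 + 1 - h).+1 < m.+1 by [].
  rewrite -(ltn_pmul2r pT) j1E.
  by nia.
apply/andP; split; first by lia.
apply/existsP; exists (low_bits e); apply/existsP; exists (Ordinal j1_lt).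
apply/existsP; exists w; rewrite sub_low /= j1E -/sg; apply/and3P; split.
- by lia.
- by rewrite mulnBl; lia.
- by rewrite mulnBl; lia.
Qed.

(** Each step splits an exponent into its set of top bits and the rest; at the end, [s] free bits
    per coordinate give the factor [2 ^ (m * s)]. *)
Lemma card_carries (m s t j : nat) :
  #|[set d : {ffun 'I_m -> 'I_(2 ^ (s + t))} | carries s j d]| <=
  2 ^ (m * s) * carry_count m t j.
Proof.
elim: t j => [|t IH] j.
  rewrite muln1 (leq_trans (max_card _)) // card_ffun !card_ord addn0.
  by rewrite mulnC expnM.
rewrite addnS /= big_distrr /= -(card_imset _ (@top_low_bits_inj m (s + t))).
pose X (S : {set 'I_m}) := [set d : {ffun 'I_m -> 'I_(2 ^ (s + t))} |
  (2 * j + 1 - #|S| < m) && carries s (2 * j + 1 - #|S|) d].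
apply: (@leq_trans (\sum_(S : {set 'I_m}) #|X S|)).
  under eq_bigr do rewrite -sum1_card.
  rewrite pair_big_dep /= sum1_card; apply: subset_leq_card.
  apply/subsetP => p /imsetP[d]; rewrite inE => cd ->.
  have : low_bits d \in X (top_bits d) by rewrite inE carries_low ?leq_addr.
  by [].
rewrite [X in _ <= X]big_mkcond /=; apply: leq_sum => S _.
rewrite /X; case: ifP => [lt_m|ge_m] /=; first exact: IH.
by rewrite eq_card0 // => d; rewrite inE.
Qed.

(** If the sum of the [e i] is [a * (q - 1) + b + 1], its reduced exponent is [b + 1], and adding
    [a] gives [a * q + b + 1]. So [a] serves both as the carry [w] fed in at the bottom and as the
    carry [j0] out of the top. *)
Lemma bad_exponent_carries (m s t : nat) (d : {ffun 'I_m -> 'I_(2 ^ (s + t))}) :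
  0 < t -> ~~ good_exponent (2 ^ s) d -> carries s 0 d.
Proof.
move=> t_gt0; rewrite negb_forall => /existsP[e].
rewrite negb_imply -leqNgt => /andP[de].
set q := 2 ^ (s + t); set sg := \sum_i e i.
have ps : 0 < 2 ^ s by rewrite expn_gt0.
have sq : 2 * 2 ^ s <= q by rewrite -expnS leq_pexp2l //; lia.
rewrite /reduced_exponent; case: eqP => [_|/eqP sg0]; first by lia.
have := divn_eq sg.-1 q.-1; have := @ltn_pmod sg.-1 q.-1.
set a := _ %/ _; set b := _ %% _ => b_lt E b_ge.
have sg_le : sg <= m * q.-1.
  rewrite /sg -[X in X * _]card_ord -sum_nat_const; apply: leq_sum => i _.
  by have := ltn_ord (e i); rewrite -/q; lia.
have a_lt : a < m.
  have : a * q.-1 < m * q.-1 by lia.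
  by rewrite ltn_mul2r => /andP[].
apply/existsP; exists e; apply/existsP; exists (Ordinal a_lt).
apply/existsP; exists (Ordinal a_lt); rewrite de /= -/q -/sg.
have -> : sg + a = a * q + b.+1 by nia.
by rewrite mulSn; apply/andP; split; lia.
Qed.

Lemma card_bad_exponent (m s t : nat) : 0 < t ->
  #|[set d : {ffun 'I_m -> 'I_(2 ^ (s + t))} | ~~ good_exponent (2 ^ s) d]| <=
  2 ^ (m * s) * carry_count m t 0.
Proof.
move=> t_gt0; apply: leq_trans (card_carries m s t 0); apply: subset_leq_card.
by apply/subsetP => d; rewrite !inE; apply: bad_exponent_carries.
Qed.

Lemma submask_leq (m q : nat) (d e : {ffun 'I_m -> 'I_q}) i : submask d e -> e i <= d i.
Proof.
by move=> /forallP/(_ i); case: leqP => // ed; rewrite bin_small.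
Qed.

Lemma reduced_exponent_id (q k : nat) : k < q -> reduced_exponent q k = k.
Proof.
rewrite /reduced_exponent; case: eqP => [->//|/eqP k0 kq].
by rewrite modn_small; lia.
Qed.

Lemma small_exponent_good (m q r : nat) (d : {ffun 'I_m -> 'I_q}) :
  \sum_i d i < q - r -> good_exponent r d.
Proof.
move=> dq; apply/forallP => e; apply/implyP => de.
have ed : \sum_i e i <= \sum_i d i by apply: leq_sum => i _; exact: submask_leq.
have {}ed := leq_ltn_trans ed dq.
by rewrite reduced_exponent_id // (leq_trans ed) // leq_subr.
Qed.

(** A crude bound, but of the order of [q ^ m] for fixed [m]: exponents with entries below
    [2 ^ (l - m)] have sum below [m * 2 ^ (l - m) <= 2 ^ (l - 1) <= 2 ^ l - 2 ^ s]. *)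
Lemma card_good_exponent_ge (m s l : nat) : 0 < m <= l -> s < l ->
  2 ^ (m * (l - m)) <=
  #|[set d : {ffun 'I_m -> 'I_(2 ^ l)} | good_exponent (2 ^ s) d]|.
Proof.
move=> /andP[m0 ml] sl.
have lt_l (x : 'I_(2 ^ (l - m))) : x < 2 ^ l.
  by rewrite (leq_trans (ltn_ord x)) // leq_pexp2l // leq_subr.
pose w (d : {ffun 'I_m -> 'I_(2 ^ (l - m))}) : {ffun 'I_m -> 'I_(2 ^ l)} :=
  [ffun i => Ordinal (lt_l (d i))].
have w_inj : injective w.
  move=> d1 d2 /ffunP eqw; apply/ffunP => i; apply: val_inj.
  by have := congr1 val (eqw i); rewrite !ffunE.
apply: (@leq_trans #|[set w d | d in [set: {ffun 'I_m -> 'I_(2 ^ (l - m))}]]|).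
  by rewrite card_imset // cardsT card_ffun !card_ord -expnM mulnC.
apply: subset_leq_card; apply/subsetP => _ /imsetP[d _ ->]; rewrite inE.
apply: small_exponent_good.
have -> : \sum_i w d i = \sum_i d i by apply: eq_bigr => i _; rewrite ffunE.
have p0 : 0 < 2 ^ (l - m) by rewrite expn_gt0.
have d_lt : \sum_i d i < m * 2 ^ (l - m).
  apply: (@leq_ltn_trans (m * (2 ^ (l - m)).-1)); last by nia.
  rewrite -[X in X * _]card_ord -sum_nat_const; apply: leq_sum => i _.
  by have := ltn_ord (d i); lia.
have m_le : 2 * m <= 2 ^ m.
  rewrite -{2}(prednK m0) expnS.
  by have := ltn_expl m.-1 (isT : 1 < 2); lia.
have lE : 2 ^ l = 2 ^ m * 2 ^ (l - m) by rewrite -expnD subnKC.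
have sE : 2 * 2 ^ s <= 2 ^ l by rewrite -expnS leq_pexp2l.
by nia.
Qed.

Local Open Scope ring_scope.

(** * Evaluation of good monomials on lines *)

Lemma expr_reduced_exponent (F : finFieldType) (x : F) (k : nat) :
  x ^+ reduced_exponent #|F| k = x ^+ k.
Proof.
rewrite /reduced_exponent; case: eqP => [->//|/eqP k0].
have q_gt1 := finNzRing_gt1 F.
have shift n : x ^+ (n.+1 + #|F|.-1) = x ^+ n.+1.
  by rewrite addSnnS prednK ?exprD ?expf_card ?exprSr // ltnW.
set q := #|F| in q_gt1 shift *.
have -> : k = (k.-1 %/ q.-1 * q.-1 + (k.-1 %% q.-1).+1)%N.
  by rewrite addnS -divn_eq prednK // lt0n.
set b := (k.-1 %% q.-1)%N; rewrite [LHS](_ : _ = x ^+ b.+1); last first.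
  by congr (x ^+ _); rewrite addnS /= modnMDl modn_small // ltn_pmod; lia.
elim: (_ %/ _)%N => [|c IH]; first by rewrite mul0n add0n.
by rewrite mulSn -addnA addnC addnS shift -addnS.
Qed.

Definition monomial (F : finFieldType) (m : nat) (d : {ffun 'I_m -> 'I_#|F|})
  (x : {ffun 'I_m -> F}) : F := \prod_i x i ^+ d i.

Definition line (F : finFieldType) (m : nat) (a b : {ffun 'I_m -> F}) (t : F) :
  {ffun 'I_m -> F} := [ffun i => a i + t * b i].

Definition good_set (m q r : nat) : {set {ffun 'I_m -> 'I_q}} :=
  [set d | good_exponent r d].

Section Lifted.
Variables (F : finFieldType) (m r : nat).
Local Notation q := #|F|.
Local Notation point := {ffun 'I_m -> F}.
Local Notation exponent := {ffun 'I_m -> 'I_q}.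

(** The inverse of the Vandermonde matrix at all points of [F] gives, in each variable, weights dual
    to the powers below [q]; the products [W] of such weights extract single coefficients. *)
Lemma monomials_free (c : exponent -> F) :
  (forall x : point, \sum_d c d * monomial d x = 0) -> forall d, c d = 0.
Proof.
move=> c0 d; pose V := Vandermonde q (\row_(x < q) enum_val x : 'rV[F]_q).
have V_unit : V \in unitmx.
  rewrite unitmxE det_Vandermonde unitfE; apply/prodf_neq0 => i _.
  apply/prodf_neq0 => j ij; rewrite !mxE subr_eq0 (inj_eq enum_val_inj).
  by rewrite neq_ltn ij orbT.
have dual (i j : 'I_q) :
    \sum_(x : F) x ^+ i * invmx V (enum_rank x) j = (i == j)%:R.
  have := congr1 (fun M : 'M_q => M i j) (mulmxV V_unit); rewrite !mxE => <-.
  rewrite (reindex_onto enum_val enum_rank) => [|x _]; last exact: enum_rankK.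
  apply: eq_big => [x|x _]; first by rewrite enum_valK eqxx.
  by rewrite !mxE enum_valK.
pose W (x : point) := \prod_i invmx V (enum_rank (x i)) (d i).
have orth d' : \sum_x monomial d' x * W x = (d' == d)%:R.
  under eq_bigr do rewrite -big_split /=.
  rewrite -(bigA_distr_bigA (fun i x => x ^+ d' i * invmx V (enum_rank x) (d i))) /=.
  rewrite (eq_bigr _ (fun i _ => dual (d' i) (d i))).
  have [->|/eqP neq] := eqVneq d' d; first by rewrite big1 // => i _; rewrite eqxx.
  apply/eqP/prodf_eq0; apply/exists_inP.
  rewrite -[X in is_true X]negbK; apply/negP => /exists_inPn all_eq; apply: neq.
  apply/ffunP => i; apply/eqP.
  by have := all_eq i isT; case: (d' i == d i) => //=; rewrite eqxx.
have : \sum_x (\sum_d' c d' * monomial d' x) * W x = 0.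
  by rewrite big1 // => x _; rewrite c0 mul0r.
under eq_bigr do rewrite mulr_suml.
rewrite exchange_big /= (bigD1 d) //= [X in _ + X]big1 => [|d' dd']; last first.
  under eq_bigr do rewrite -mulrA.
  by rewrite -mulr_sumr orth (negbTE dd') mulr0.
by under eq_bigr do rewrite -mulrA; rewrite -mulr_sumr orth eqxx mulr1 addr0.
Qed.

(** Double counting of the pairs [(b, t)], both nonzero, whose point lies in [U]: for fixed [t] the
    point determines [b], so there are at most [(q - 1) * #|U|] pairs, whereas [r] for every
    direction would make [r * (q ^ m - 1)]. *)
Lemma card_direction (U : {set point}) (a : point) :
  (q.-1 * #|U| < r * (q ^ m).-1)%N ->
  exists2 b : point, b != 0 & (#|[set t : F | t != 0%R & line a b t \in U]| < r)%N.
Proof.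
move=> U_small; apply/exists_inP; rewrite -[X in is_true X]negbK; apply/negP.
move=> /exists_inPn; rewrite /= => r_le; move: U_small; apply/negP.
rewrite -leqNgt; apply: (@leq_trans
  (\sum_(b : point | b != 0%R) #|[set t : F | t != 0%R & line a b t \in U]|)).
  rewrite mulnC -[X in (X <= _)%N](_ : (\sum_(b : point | b != 0%R) r = _)%N).
    by apply: leq_sum => b b0; rewrite leqNgt; apply: r_le.
  by rewrite sum_nat_const cardC1 card_ffun card_ord.
under eq_bigr => b b0 do rewrite -sum1_card.
under eq_bigr do under eq_bigl do rewrite inE.
rewrite (exchange_big_dep (fun t : F => t != 0)) /=; last by move=> b t _ /andP[].
rewrite -(cardC1 (0 : F)) -sum_nat_const; apply: leq_sum => t t0.
rewrite sum1_card.
have line_inj : injective (fun b => line a b t).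
  move=> b1 b2 /ffunP eqb; apply/ffunP => i; have := eqb i; rewrite !ffunE.
  by move=> /addrI /(mulfI t0).
rewrite -(card_imset _ line_inj); apply: subset_leq_card.
by apply/subsetP => _ /imsetP[b /and3P[_ _ bU] ->].
Qed.

Hypothesis char2 : (2 \in [pchar F])%N.

(** In the expansion of the product of the [(a i + t * b i) ^ d i], only submasks of [d] can have a
    nonzero coefficient in characteristic 2, and reducing the powers of [t] leaves their values on
    [F] unchanged. *)
Lemma monomial_line (d : exponent) (a b : point) : good_exponent r d ->
  exists2 h : {poly F}, (size h <= q - r)%N &
    forall t, h.[t] = monomial d (line a b t).
Proof.
move=> /forallP good_d.
pose c (e : exponent) := \prod_i (('C(d i, e i))%:R * a i ^+ (d i - e i) * b i ^+ e i).
pose h : {poly F} := \sum_(e : exponent | submask d e)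
  c e *: 'X^(reduced_exponent q (\sum_i e i)).
exists h => [|t].
  apply: leq_trans (size_sum _ _ _) _; apply/bigmax_leqP => e de.
  apply: leq_trans (size_scale_leq _ _) _; rewrite size_polyXn.
  exact: (implyP (good_d e)).
have bin2 n k : ('C(n, k))%:R = (odd 'C(n, k))%:R :> F.
  by rewrite -[LHS](GRing.natr_mod_pchar char2) modn2.
have expand i : line a b t i ^+ d i = \sum_(e < q)
    ('C(d i, e))%:R * a i ^+ (d i - e) * b i ^+ e * t ^+ e.
  rewrite ffunE exprDn.
  rewrite (big_ord_widen q (fun e => a i ^+ (d i - e) * (t * b i) ^+ e *+ 'C(d i, e))) //.
  rewrite big_mkcond /=; apply: eq_bigr => e _.
  case: ifP => [_|/negbT]; first by rewrite exprMn -mulr_natl -!mulrA [t ^+ e * _]mulrC.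
  by rewrite -leqNgt => ?; rewrite bin_small // !mul0r.
rewrite /monomial (eq_bigr _ (fun i _ => expand i)).
rewrite (bigA_distr_bigA (fun i (e : 'I_q) =>
   ('C(d i, e))%:R * a i ^+ (d i - e) * b i ^+ e * t ^+ e)) /=.
rewrite horner_sum big_mkcond /=; apply: eq_bigr => e _.
rewrite big_split /= -/(c e).
rewrite prodrXr.
case: ifP => [de|/negbT].
  by rewrite hornerZ hornerXn expr_reduced_exponent.
rewrite negb_forall => /existsP[i /negbTE even_i].
by rewrite /c (bigD1 i) //= bin2 even_i !mul0r.
Qed.

Definition lifted_word (c : exponent -> F) (x : point) : F :=
  \sum_(d in good_set m q r) c d * monomial d x.

(** On the line the word is a polynomial in [t] of size at most [q - r]; having [q - r] roots it is
    zero, in particular at [t = 0], which is the point [a]. *)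
Lemma lifted_word_line (c : exponent -> F) (a b : point) (A : {set F}) :
  (q - r <= #|A|)%N -> (forall t, t \in A -> lifted_word c (line a b t) = 0) ->
  lifted_word c a = 0.
Proof.
move=> card_A vanish.
have [h size_h hE] : exists2 h : {poly F}, (size h <= q - r)%N &
    forall t, h.[t] = lifted_word c (line a b t).
  have ex d : exists h : {poly F}, (d \in good_set m q r) ->
      (size h <= q - r)%N /\ forall t, h.[t] = monomial d (line a b t).
    have [|] := boolP (d \in good_set m q r); last by exists 0.
    by rewrite inE => gd; have [h] := monomial_line a b gd; exists h.
  have [H HE] := fin_all_exists ex.
  exists (\sum_(d in good_set m q r) c d *: H d) => [|t].
    apply: leq_trans (size_sum _ _ _) _; apply/bigmax_leqP => d gd.
    by apply: leq_trans (size_scale_leq _ _) _; have [] := HE d gd.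
  rewrite horner_sum; apply: eq_bigr => d gd.
  by rewrite hornerZ; have [_ ->] := HE d gd.
have a_line : line a b 0 = a by apply/ffunP => i; rewrite ffunE mul0r addr0.
rewrite -a_line -hE; have [->|h0] := eqVneq h 0; first by rewrite horner0.
have := max_poly_roots h0 (rs := enum A).
rewrite enum_uniq -cardE => max_roots; exfalso.
have : (#|A| < size h)%N.
  apply: max_roots => //; apply/allP => t; rewrite mem_enum => tA.
  by rewrite /root hE vanish.
by move=> /leq_trans/(_ size_h); rewrite ltnNge card_A.
Qed.

(** By linearity, this means that the values of a word on [Q] determine its value at [a]. *)
Definition recovers (a : point) (Q : {set point}) : Prop :=
  forall c : exponent -> F,
    (forall p, p \in Q -> lifted_word c p = 0) -> lifted_word c a = 0.

(** Of the [q - 1] other points of a suitable line through [a], fewer than [r] lie in [U], so at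
    least [q - r] remain. *)
Lemma exists_recovery_set (U : {set point}) (a : point) :
  (q.-1 * #|U| < r * (q ^ m).-1)%N ->
  exists Q, [/\ recovers a Q, (#|Q| <= q.-1)%N & [disjoint Q & U]].
Proof.
move=> /(card_direction a)[b b0 lt_r].
pose A := [set t : F | t != 0 & line a b t \notin U].
have cardA : (#|[set t : F | t != 0%R & line a b t \in U]| + #|A| = q.-1)%N.
  rewrite -(cardC1 (0 : F)) -sum1_card -[in RHS]sum1_card -[X in (_ + X)%N]sum1_card.
  rewrite [RHS](bigID (fun t => line a b t \in U)) /=.
  by congr addn; apply: eq_bigl => t; rewrite !inE.
have line_inj : injective (line a b).
  have [i bi] : exists i, b i != 0.
    apply/existsP; rewrite -[X in is_true X]negbK; apply/negP => /existsPn b_eq0.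
    move: b0; apply/negP; rewrite negbK; apply/eqP/ffunP => i; rewrite ffunE.
    by apply/eqP; have := b_eq0 i; rewrite negbK.
  move=> t1 t2 /ffunP/(_ i); rewrite !ffunE => /addrI.
  by move/(mulIf bi).
exists [set line a b t | t in A]; split.
- move=> c vanish; apply: (@lifted_word_line c a b A) => [|t tA]; first by lia.
  by apply: vanish; apply: imset_f.
- by rewrite card_imset // -cardA leq_addl.
- rewrite disjoint_subset; apply/subsetP => _ /imsetP[t + ->].
  by rewrite !inE => /andP[].
Qed.

End Lifted.

(** * Greedy choice of recovery sets and the resulting batch code *)

(** The sets are chosen in turn, [U] being the union of the earlier ones: at most [K - 1] sets of at
    most [M] elements. *)
Lemma greedy_disjoint (T : finType) (P : T -> {set T} -> Prop) (M K : nat) :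
  (forall (U : {set T}) (a : T), (#|U| <= M * K.-1)%N ->
     exists Q, [/\ P a Q, (#|Q| <= M)%N & [disjoint Q & U]]) ->
  forall a : nat -> T, exists Q : nat -> {set T},
    (forall i, i < K -> P (a i) (Q i))%N /\
    (forall i j, i < K -> j < K -> i != j -> [disjoint Q i & Q j])%N.
Proof.
move=> step a.
suff ind k : (k <= K)%N -> exists Q : nat -> {set T},
    [/\ (forall i, i < k -> P (a i) (Q i))%N,
        (forall i, #|Q i| <= M)%N &
        (forall i j, i < k -> j < k -> i != j -> [disjoint Q i & Q j])%N].
  by have [Q [PQ _ dQ]] := ind K (leqnn K); exists Q.
elim: k => [|k IH] lt_k.
  by exists (fun=> set0); split=> // i; rewrite cards0.
have [Q [PQ cQ dQ]] := IH (ltnW lt_k).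
pose U := \bigcup_(i < k) Q i.
have cardU : (#|U| <= M * K.-1)%N.
  apply: (@leq_trans (\sum_(i < k) #|Q i|)).
    rewrite /U; elim/big_rec2: _ => [|i n V _ le_n]; first by rewrite cards0.
    by rewrite (leq_trans (leq_card_setU _ _)) // leq_add2l.
  apply: (@leq_trans (\sum_(i < k) M)); first by apply: leq_sum.
  by rewrite sum_nat_const card_ord mulnC leq_mul2l; apply/orP; right; lia.
have [V [PV cV dV]] := step U (a k) cardU.
have disjV i : (i < k)%N -> [disjoint V & Q i].
  move=> ik; apply: disjointWr dV.
  exact: (bigcup_sup (Ordinal ik)).
exists (fun i => if i == k then V else Q i); split.
- move=> i; rewrite ltnS leq_eqVlt; case: eqP => [->|_] //=; exact: PQ.
- by move=> i; case: eqP.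
- have split_lt i : (i < k.+1)%N = (i == k) || (i < k)%N by rewrite ltnS leq_eqVlt.
  move=> i j; rewrite !split_lt.
  case: eqP => [->|_] /=; case: eqP => [->|_] //=.
  + by rewrite eqxx.
  + by move=> _ jk _; apply: disjV.
  + by move=> ik _ _; rewrite disjoint_sym; apply: disjV.
  + exact: dQ.
Qed.

(** The recovery function searches for some message whose codeword has the given values; 0 is an
    arbitrary answer where there is none. *)
Lemma batch_of_determined (F : finFieldType) (n N k : nat)
    (E : 'rV[F]_n -> 'rV[F]_N) :
  injective E ->
  (forall u : 'I_k -> 'I_n, exists Q : 'I_k -> {set 'I_N},
     (forall i j, i != j -> [disjoint Q i & Q j]) /\
     forall j x x', (forall p, p \in Q j -> E x ord0 p = E x' ord0 p) ->
       x ord0 (u j) = x' ord0 (u j)) ->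
  is_batch_code E k.
Proof.
move=> E_inj det; split=> // u; have [Q [dQ detQ]] := det u.
exists Q, (fun j z =>
  if [pick x | proj (Q j) (E x) == z] is Some x then x ord0 (u j) else 0).
split=> // x j; case: pickP => [x' /eqP/ffunP projE|/(_ x)/eqP//].
apply: detQ => p pQ.
by have := projE (exist _ p pQ); rewrite !ffunE.
Qed.

(** Inverting the submatrix of [n] independent columns of [G] makes every message symbol a code
    symbol, so that it suffices to recover values at points. *)
Lemma systematic_generator (F : fieldType) (n N : nat) (G : 'M[F]_(n, N)) :
  row_free G -> exists (T : 'M[F]_n) (f : 'I_n -> 'I_N),
    forall (x : 'rV[F]_n) i, (x *m T *m G) ord0 (f i) = x ord0 i.
Proof.
move=> G_free; have Gt_full : row_full G^T.
  by rewrite /row_full mxrank_tr.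
pose f := fullrankfun Gt_full; exists (invmx (rowsub f G^T)^T), f => x i.
have M_unit : (rowsub f G^T)^T \in unitmx by rewrite unitmx_tr fullrowsub_unit.
rewrite -[RHS](congr1 (fun y : 'rV_n => y ord0 i) (mulmxKV M_unit x)).
by rewrite !mxE; apply: eq_bigr => j _; rewrite !mxE.
Qed.

Lemma lifted_batch_code (F : finFieldType) (m r k : nat) :
  (2 \in [pchar F])%N -> (0 < m)%N -> (k.-1 * #|F| < r * #|F| ^ m.-1)%N ->
  exists E : 'rV[F]_(#|good_set m #|F| r|) -> 'rV[F]_(#|F| ^ m),
    is_batch_code E k.
Proof.
move=> char2 m_gt0 k_small; set q := #|F| in k_small *.
have q_gt1 : (1 < q)%N by apply: finNzRing_gt1.
pose good := good_set m q r.
have card_pt : (q ^ m)%N = #|{ffun 'I_m -> F}| by rewrite card_ffun card_ord.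
pose pt (p : 'I_(q ^ m)) : {ffun 'I_m -> F} := enum_val (cast_ord card_pt p).
pose pos (x : {ffun 'I_m -> F}) : 'I_(q ^ m) := cast_ord (esym card_pt) (enum_rank x).
have ptK : cancel pt pos by move=> p; rewrite /pt /pos enum_valK cast_ordK.
have posK : cancel pos pt by move=> p; rewrite /pt /pos cast_ordKV enum_rankK.
pose G : 'M[F]_(#|good|, q ^ m) := \matrix_(i, p) monomial (enum_val i) (pt p).
pose coef (y : 'rV[F]_#|good|) (d : {ffun 'I_m -> 'I_q}) : F :=
  if [pick i | enum_val i == d] is Some i then y ord0 i else 0.
have coefE y i : coef y (enum_val i) = y ord0 i.
  rewrite /coef; case: pickP => [i' /eqP/enum_val_inj->//|/(_ i)].
  by rewrite eqxx.
have wordE y p : (y *m G) ord0 p = lifted_word r (coef y) (pt p).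
  rewrite mxE /lifted_word [RHS]big_enum_val /=; apply: eq_bigr => i _.
  by rewrite mxE coefE.
have G_free : row_free G.
  apply: inj_row_free => v vG0; apply/rowP => i.
  rewrite -coefE mxE; have : (if enum_val i \in good then coef v (enum_val i) else 0) = 0.
    apply: (@monomials_free F m (fun d => if d \in good then coef v d else 0)) => x.
    transitivity (lifted_word r (coef v) x).
      rewrite /lifted_word [RHS]big_mkcond; apply: eq_bigr => d _.
      by rewrite -/good; case: ifP => // _; rewrite mul0r.
    by rewrite -[x]posK -wordE vG0 mxE.
  by rewrite enum_valP.
have [T [f Tf]] := systematic_generator G_free.
exists (fun x => x *m T *m G); apply: batch_of_determined.
  by move=> x x' eqE; apply/rowP => i; rewrite -!Tf eqE.
move=> u.
(* Requests are indexed by [nat] here; those from [k] on ask for a dummy point. *)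
have [|Q [recQ dQ]] := @greedy_disjoint _ (@recovers F m r) q.-1 k _
  (fun j => if insub j is Some j' then pt (f (u j')) else [ffun=> 0]).
  move=> U a cardU; apply: exists_recovery_set => //.
  have q_pow : (q ^ m = q * q ^ m.-1)%N by rewrite -expnS prednK.
  have q_pow0 : (0 < q ^ m.-1)%N by rewrite expn_gt0 ltnW.
  rewrite -/q q_pow; set X := (q ^ m.-1)%N in k_small q_pow0 *.
  (* [(q - 1) * (k - 1) * q < (q - 1) * r * X = r * (q * X - X) <= r * (q * X - 1)]. *)
  apply: (@leq_ltn_trans (q.-1 * (k.-1 * q))).
    by rewrite leq_mul2l (leq_trans cardU) ?orbT // mulnC leq_mul2l leq_pred orbT.
  apply: (@leq_trans (q.-1 * (r * X))); first by rewrite ltn_pmul2l //; lia.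
  by rewrite mulnCA leq_mul2l -[X in (X * _)%N]subn1 mulnBl; apply/orP; right; lia.
exists (fun j => [set p | pt p \in Q j]); split.
  move=> i j ij; rewrite disjoint_subset; apply/subsetP => p; rewrite !inE.
  have := dQ i j (ltn_ord i) (ltn_ord j) ij; rewrite disjoint_subset.
  by move/subsetP/(_ (pt p)); rewrite inE.
move=> j x x' eqE; apply/eqP; rewrite -subr_eq0; apply/eqP.
have -> : x ord0 (u j) - x' ord0 (u j) = (x - x') ord0 (u j) by rewrite !mxE.
rewrite -Tf wordE.
have := recQ j (ltn_ord j); rewrite valK; apply=> p pQ.
rewrite -[p]posK -wordE !mulmxBl mxE [X in _ + X]mxE eqE ?subrr //.
by rewrite inE posK.
Qed.

(** * A Perron eigenvector and the growth of the carry count *)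

From mathcomp Require Import all_classical all_reals all_analysis.
Import numFieldNormedType.Exports.
Local Open Scope classical_set_scope.

Lemma ex_pos_lower_bound (R : realType) n (g : 'I_n -> R) :
  (forall i, 0 < g i) -> exists2 mu, 0 < mu & forall i, mu <= g i.
Proof.
case: n g => [|n] g g_gt0; first by exists 1 => // -[].
case: (arg_minP g (isT : predT (ord0 : 'I_n.+1))) => i _ le_i.
by exists (g i) => // j; apply: le_i.
Qed.

Section CollatzWielandt.
Variables (R : realType) (n : nat) (B : 'M[R]_n.+1).
Hypothesis B_ge0 : forall i j, 0 <= B i j.

Let vec (z : 'rV[R]_n.+2) : 'cV[R]_n.+1 := \col_i z ord0 (lift ord0 i).

(** Pairs of a number [t] and a vector [x] of the simplex with [t x <= B x], packed into one row,
    [t] first, so that the extreme value theorem for row vectors applies. The largest [t] is the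
    Perron root. *)
Definition collatz_wielandt_set : set 'rV[R]_n.+2 :=
  [set z : 'rV[R]_n.+2 | [/\ forall i, 0 <= z ord0 i, \sum_i vec z i 0 = 1 &
    forall i, z ord0 ord0 * vec z i 0 <= (B *m vec z) i 0]].

Lemma collatz_wielandt_set_compact : compact collatz_wielandt_set.
Proof.
pose C : R := 1 + \sum_i \sum_j B i j.
have C_ge1 : 1 <= C.
  by rewrite lerDl sumr_ge0 // => i _; rewrite sumr_ge0.
apply: (@subclosed_compact _ _ [set v : 'rV[R]_n.+2 | forall i, `[0, C]%classic (v ord0 i)]).
- have -> : collatz_wielandt_set =
      \bigcap_i [set z : 'rV[R]_n.+2 | 0 <= z ord0 i] `&`
      ([set z : 'rV[R]_n.+2 | \sum_i vec z i 0 = 1] `&`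
       \bigcap_i [set z : 'rV[R]_n.+2 | z ord0 ord0 * vec z i 0 <= (B *m vec z) i 0]).
    apply/seteqP; split=> z /=.
      by move=> [z0 z1 zB]; split=> [i _|]; [exact: z0 | split=> // i _; exact: zB].
    by move=> [z0 [z1 zB]]; split=> // i; [exact: z0 | exact: zB].
  have cont_vec i : continuous (fun z => vec z i 0).
    have -> : (fun z => vec z i 0) = (fun z : 'rV[R]_n.+2 => z ord0 (lift ord0 i)).
      by apply/funext => z; rewrite mxE.
    exact: coord_continuous.
  have cont_t : continuous (fun z : 'rV[R]_n.+2 => z ord0 ord0) by exact: coord_continuous.
  have cont_B i : continuous (fun z => (B *m vec z) i 0).
    have -> : (fun z => (B *m vec z) i 0) = (fun z => \sum_j B i j * vec z j 0).
      by apply/funext => z; rewrite mxE.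
    apply: continuous_big => [|j _ z]; first exact: add_continuous.
    by apply: continuousM; [exact: cst_continuous | exact: cont_vec].
  apply: closedI; last apply: closedI.
  + apply: closed_bigI => i _.
    apply: (@preimage_closed _ _ (fun z : 'rV[R]_n.+2 => z ord0 i) [set x | 0 <= x]).
      by move=> z _; exact: coord_continuous.
    exact: closed_ge.
  + apply: (@preimage_closed _ _ (fun z => \sum_i vec z i 0) [set x | x = 1]).
      move=> z _; apply: continuous_big => [|j _]; first exact: add_continuous.
      exact: cont_vec.
    exact: closed_eq.
  + apply: closed_bigI => i _.
    have -> : [set z : 'rV[R]_n.+2 | z ord0 ord0 * vec z i 0 <= (B *m vec z) i 0] =
       (fun z => (B *m vec z) i 0 - z ord0 ord0 * vec z i 0) @^-1` [set x : R | 0 <= x].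
      by apply/seteqP; split=> z /=; rewrite subr_ge0.
    apply: preimage_closed; last exact: closed_ge.
    by move=> z _; exact: (cvgB (cont_B i z) (cvgM (cont_t z) (cont_vec i z))).
- apply: (@rV_compact _ _ (fun=> `[0, C]%classic)) => i; exact: segment_compact.
move=> z [z0 z1 zB] i /=; rewrite in_itv /= z0 /=.
have vec_ge0 j : 0 <= vec z j 0 by rewrite mxE.
have vec_le1 j : vec z j 0 <= 1.
  by rewrite -z1 (bigD1 j) //= lerDl sumr_ge0.
case: (unliftP ord0 i) => [j ->|->].
  by apply: le_trans C_ge1; have := vec_le1 j; rewrite mxE.
(* Summing [t x <= B x] over the coordinates bounds [t] by the sum of the entries of [B]. *)
rewrite -[X in X <= _]mulr1 -z1 mulr_sumr.
apply: le_trans (ler_sum _ (fun i _ => zB i)) _; rewrite -[X in X <= _]add0r lerD //.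
apply: ler_sum => j _; rewrite mxE; apply: ler_sum => k _.
by rewrite -[X in _ <= X]mulr1 ler_wpM2l.
Qed.

(** Let [x] attain the maximum [rho]. Were [y = B x - rho x] nonzero, [P y] would be positive in
    every coordinate, so that [w = P x] would satisfy the inequality for a number above [rho]. Hence
    [y = 0], and [w] is the positive eigenvector. *)
Lemma positive_eigenvector (P : 'M[R]_n.+1) :
  (forall i j, 0 < P i j) -> P *m B = B *m P ->
  exists (rho : R) (v : 'cV[R]_n.+1), (forall i, 0 < v i 0) /\ B *m v = rho *: v.
Proof.
move=> P_gt0 PB.
have P_pos (x : 'cV[R]_n.+1) : (forall i, 0 <= x i 0) -> x != 0 ->
    forall i, 0 < (P *m x) i 0.
  move=> x0 xn0 i; have [k xk] : exists k, x k 0 != 0.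
    apply/existsP; rewrite -[X in is_true X]negbK; apply/negP => /existsPn all0.
    move/eqP: xn0; apply; apply/colP => k; rewrite mxE; apply/eqP.
    by have := all0 k; rewrite negbK.
  rewrite mxE (bigD1 k) //= ltr_wpDr ?sumr_ge0 // => [j _|].
    by rewrite mulr_ge0 // ltW.
  by rewrite mulr_gt0 // lt_def xk x0.
have cw_n0 : collatz_wielandt_set !=set0.
  exists (delta_mx 0 (lift ord0 ord0)); split=> [i||i].
  - by rewrite mxE ler0n.
  - rewrite (bigD1 ord0) //= big1 => [|i i0]; rewrite !mxE ?eqxx ?addr0 //.
    by rewrite (inj_eq lift_inj) (negbTE i0) andbF.
  - rewrite !mxE /= mul0r; apply: sumr_ge0 => j _.
    by rewrite mulr_ge0 // !mxE ler0n.
have cont_t : {within collatz_wielandt_set,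
    continuous (fun z : 'rV[R]_n.+2 => z ord0 ord0)}.
  by apply: continuous_subspaceT; exact: coord_continuous.
have [z /set_mem[z0 z1 zB] z_max] := EVT_max_rV cw_n0 collatz_wielandt_set_compact cont_t.
set rho := z ord0 ord0 in zB z_max; set x := vec z in z1 zB.
have x0 i : 0 <= x i 0 by rewrite mxE.
have xn0 : x != 0.
  apply/eqP => xE; move: z1; rewrite xE big1 => [/esym/eqP|i _]; last by rewrite mxE.
  by rewrite oner_eq0.
pose w := P *m x; have w_gt0 := P_pos x x0 xn0; rewrite -/w in w_gt0.
exists rho, w; split=> //.
rewrite /w mulmxA -PB -mulmxA scalemxAr; congr (P *m _).
apply/eqP; rewrite -subr_eq0; apply/negPn/negP => yn0.
have y0 i : 0 <= (B *m x - rho *: x) i 0 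
  by rewrite mxE [X in _ + X]mxE [X in _ - X]mxE subr_ge0; exact: zB.
have [mu mu_gt0 mu_le] := ex_pos_lower_bound (P_pos _ y0 yn0).
pose sg := \sum_i w i 0.
have sg_gt0 : 0 < sg.
  by rewrite /sg (bigD1 ord0) //= ltr_wpDr // sumr_ge0 // => i _; exact: ltW.
have w_le i : w i 0 <= sg.
  by rewrite /sg (bigD1 i) //= lerDl sumr_ge0 // => j _; exact: ltW.
(* Dividing by [sg] normalizes [w]; the gain [mu / sg] is admissible because [w i 0 / sg <= 1] and
   [mu] is at most each coordinate of [P y]. *)
pose z' : 'rV[R]_n.+2 := \row_i
  if unlift ord0 i is Some j then w j 0 / sg else rho + mu / sg.
have vecz' : vec z' = sg^-1 *: w.
  by apply/colP => i; rewrite [LHS]mxE [LHS]mxE liftK [RHS]mxE mulrC.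
have rhoz' : z' ord0 ord0 = rho + mu / sg by rewrite mxE unlift_none.
have : collatz_wielandt_set z'.
  split.
  - move=> i; rewrite mxE; case: unliftP => [j _|_].
      by rewrite divr_ge0 // ltW.
    by rewrite addr_ge0 ?divr_ge0 ?(ltW mu_gt0) ?(ltW sg_gt0) //; exact: z0.
  - rewrite vecz'; under eq_bigr do rewrite mxE.
    by rewrite -mulr_sumr mulVf // gt_eqF.
  - move=> i; rewrite rhoz' vecz' -scalemxAr.
    have scE (u : 'cV[R]_n.+1) : (sg^-1 *: u) i 0 = sg^-1 * u i 0 by rewrite mxE.
    rewrite !scE mulrCA.
    rewrite ler_pM2l ?invr_gt0 // mulrDl -lerBrDl.
    have -> : (B *m w) i 0 - rho * w i 0 = (P *m (B *m x - rho *: x)) i 0.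
      by rewrite mulmxBr [P *m (B *m x)]mulmxA PB -mulmxA -scalemxAr
        [RHS]mxE [X in _ = _ + X]mxE [X in _ = _ - X]mxE.
    apply: le_trans (mu_le i); rewrite -mulrA ger_pMr // mulrC.
    by rewrite ler_pdivrMr // mul1r.
move=> /mem_set/z_max; rewrite rhoz' gerDl leNgt divr_gt0 //.
Qed.

End CollatzWielandt.

(** * The matrix [Amat] as transition matrix of the carries *)

(** Entry [(j, c)] counts the sets [S] that lead from [j] to [c]; the truncated subtraction sends
    all [S] with at least [2 * j + 1] elements to 0, whence the special column 0. *)
Lemma carry_count_Amat (R : pzRingType) (m t : nat) (j : 'I_m) :
  (carry_count m t.+1 j)%:R =
  \sum_(c < m) Amat R m j c * (carry_count m t c)%:R.
Proof.
pose g (S : {set 'I_m}) := (2 * j + 1 - #|S|)%N.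
have entry (c : 'I_m) : Amat R m j c = #|[set S | g S == c]%SET|%:R.
  rewrite mxE; congr (_%:R); have [c0|c0] := eqVneq (c : nat) 0%N.
    by rewrite c0; apply: eq_card => S; rewrite !inE.
  case: leqP => [cj|jc].
    have -> k : 'C(m, k) = #|[set S : {set 'I_m} | #|S| == k]%SET|.
      by rewrite card_draws card_ord.
    apply: eq_card => S.
    by rewrite !inE /g; apply/eqP/eqP; lia.
  by rewrite eq_card0 // => S; rewrite !inE /g; apply/eqP; lia.
under eq_bigr do rewrite entry -natrM.
rewrite -natr_sum; congr (_%:R) => /=.
transitivity (\sum_(S : {set 'I_m} | (g S < m)%N)
    \sum_(c < m | g S == c) carry_count m t c)%N.
  apply: eq_bigr => S gm; rewrite (big_pred1 (Ordinal gm)) // => c /=.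
  by rewrite eq_sym.
rewrite (exchange_big_dep xpredT) //=; apply: eq_bigr => c _.
rewrite sum_nat_const; congr muln; apply: eq_card => S; rewrite !inE unfold_in.
by case: eqP => [->|_]; rewrite ?ltn_ord ?andbF.
Qed.

(** From the carry [m - 1] only the full set keeps the next carry below [m], and that carry is again
    [m - 1]. *)
Lemma Amat_last_row (R : pzRingType) n (c : 'I_n.+1) :
  Amat R n.+1 ord_max c = (c == ord_max)%:R.
Proof.
rewrite mxE /= -val_eqE /=; congr (_%:R); have c_lt := ltn_ord c.
case: eqP => [->|/eqP c0].
  rewrite /binom_ge; case: n c c_lt => [|n] c c_lt /=.
    rewrite (eq_card (B := pred1 [set: 'I_1]%SET)) ?card1 // => S.
    by rewrite !inE eqEcard finset.subsetT /= cardsT card_ord.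
  rewrite eq_card0 // => S; rewrite !inE; apply/negbTE; rewrite -ltnNge.
  by rewrite (leq_ltn_trans (max_card _)) // card_ord; lia.
rewrite ifT; last by lia.
case: (ltngtP c n) => [cn|nc|->]; [|by lia|].
  by rewrite bin_small //; lia.
by rewrite (_ : _ - _ = n.+1)%N ?binn //; lia.
Qed.

Lemma carry_count_last n t : carry_count n.+1 t n = 1%N.
Proof.
elim: t => //= t IH; rewrite (big_pred1 [set: 'I_n.+1]%SET) => [|S /=].
  by rewrite cardsT card_ord (_ : _ - _ = n)%N //; lia.
rewrite eqEcard finset.subsetT cardsT card_ord /=; lia.
Qed.

(** [eigenvalue] refers to row vectors; a column eigenvector also makes [A - a] singular. *)
Lemma right_eigenvalue (F : fieldType) n (A : 'M[F]_n) (a : F) (v : 'cV[F]_n) :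
  v != 0 -> A *m v = a *: v -> eigenvalue A a.
Proof.
move=> v0 Av; rewrite /eigenvalue /eigenspace kermx_eq0 row_free_unit.
apply/negP => A_unit; move: v0.
by rewrite -[v](mulKmx A_unit) mulmxBl Av mul_scalar_mx subrr mulmx0 eqxx.
Qed.

Section PerronAmat.
Variables (R : realType) (n : nat).
Local Notation m := n.+2.

(** The last state is dropped because it leads only to itself, which makes [Amat] reducible. *)
Definition main_block : 'M[R]_n.+1 :=
  \matrix_(i, j) Amat R m (widen_ord (leqnSn _) i) (widen_ord (leqnSn _) j).
Local Notation B := main_block.

Lemma main_block_ge0 i j : 0 <= B i j.
Proof. by rewrite mxE mxE ler0n. Qed.

(** The full set leads from [i] to [2 * i + 1 - m], which is smaller than [i] when
    [0 < i <= m - 2]. *)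
Lemma main_block_down (i : 'I_n.+1) :
  exists2 l : 'I_n.+1, (l <= i.-1)%N & (0 < i)%N -> 0 < B i l.
Proof.
have i_lt := ltn_ord i; have l_lt : (2 * i + 1 - m < n.+1)%N by lia.
exists (Ordinal l_lt) => [|i0]; first by rewrite /=; lia.
rewrite mxE mxE /= ltr0n; case: eqP => [l0|l0].
  have im : (2 * i + 1 <= m)%N by lia.
  by apply/card_gt0P; exists [set: 'I_m]%SET; rewrite inE cardsT card_ord.
by rewrite ifT ?bin_gt0; lia.
Qed.

(** With [l] the half of [j] rounded down, [2 * l + 1 - j] is 0 or 1, so a set of that size leads
    from [l] to [j]. *)
Lemma main_block_up (j : 'I_n.+1) :
  exists2 l : 'I_n.+1, (l <= j.-1)%N & (0 < j)%N -> 0 < B l j.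
Proof.
have j_lt := ltn_ord j; have l_lt : (j %/ 2 < n.+1)%N by lia.
exists (Ordinal l_lt) => [|j0]; first by rewrite /=; lia.
rewrite mxE mxE /= ltr0n ifF; last by apply/eqP; lia.
by rewrite ifT ?bin_gt0; lia.
Qed.

(** State 0 is reached from [i] within [n + 1] steps and leads to [j] within [n + 1] steps; the
    summand 1 allows waiting, so that these lengths become exact. *)
Lemma main_block_irreducible i j : 0 < ((1 + B) ^+ (n.+1 + n.+1)) i j.
Proof.
pose M : 'M[R]_n.+1 := 1 + B.
have M_diag k : 0 < M k k.
  by rewrite !mxE eqxx ltr_pwDl ?ltr01 // main_block_ge0.
have M_ge0 k l : 0 <= M k l.
  by rewrite mxE addr_ge0 ?main_block_ge0 // mxE ler0n.
have M_gt0 k l : 0 < B k l -> 0 < M k l.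
  by rewrite [M k l]mxE => Bkl; rewrite ltr_wpDl // mxE ler0n.
have MX_ge0 k a b : 0 <= (M ^+ k) a b.
  elim: k a b => [|k IH] a b; first by rewrite mxE ler0n.
  by rewrite exprS mxE sumr_ge0 // => c _; rewrite mulr_ge0.
have mul_gt0 (X Y : 'M[R]_n.+1) a b c : (forall a b, 0 <= X a b) ->
    (forall a b, 0 <= Y a b) -> 0 < X a c -> 0 < Y c b -> 0 < (X * Y) a b.
  move=> X0 Y0 Xac Ycb; rewrite mxE (bigD1 c) //= ltr_pwDl ?mulr_gt0 //.
  by apply: sumr_ge0 => d _; rewrite mulr_ge0.
have down k (a : 'I_n.+1) : (a <= k)%N -> 0 < (M ^+ k) a ord0.
  elim: k a => [|k IH] a ak.
    by rewrite expr0 mxE (_ : a == ord0) ?ltr01 // -val_eqE /= -leqn0.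
  have [l la Bal] := main_block_down a; rewrite exprS.
  apply: (mul_gt0 _ _ _ _ l) => //; last by apply: IH; lia.
  have [a0|/Bal/M_gt0//] := posnP a.
  by rewrite (_ : l = a) //; apply: val_inj => /=; lia.
have up k (a : 'I_n.+1) : (a <= k)%N -> 0 < (M ^+ k) ord0 a.
  elim: k a => [|k IH] a ak.
    by rewrite expr0 mxE eq_sym (_ : a == ord0) ?ltr01 // -val_eqE /= -leqn0.
  have [l la Bal] := main_block_up a; rewrite exprSr.
  apply: (mul_gt0 _ _ _ _ l) => //; first by apply: IH; lia.
  have [a0|/Bal/M_gt0//] := posnP a.
  by rewrite (_ : l = a) //; apply: val_inj => /=; lia.
rewrite exprD; apply: (mul_gt0 _ _ _ _ ord0) => //.
  by apply: down; rewrite ltnW.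
by apply: up; rewrite ltnW.
Qed.

Lemma binom_ge1_gt1 : (1 < binom_ge m 1)%N.
Proof.
apply/card_gt1P; exists [set ord0]%SET, [set ord_max]%SET; split.
- by rewrite inE cards1.
- by rewrite inE cards1.
- by apply/eqP => /setP/(_ ord0); rewrite !inE eqxx.
Qed.

(** [rho] exceeds 1 because the corner entry of the block does. It is at most [lambda] because
    padding the eigenvector with a final 0 gives one of [Amat], whose last row vanishes off the
    diagonal. *)
Lemma main_block_eigenvector : exists (rho : R) (v : 'I_n.+1 -> R),
  [/\ 1 < rho <= lambda R m, forall i, 0 < v i &
      forall i, \sum_j B i j * v j = rho * v i].
Proof.
have comm : (1 + B) ^+ (n.+1 + n.+1) *m B = B *m (1 + B) ^+ (n.+1 + n.+1).
  apply: commr_sym; apply: commrX; apply: commrD; first exact: commr1.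
  exact: commr_refl.
have [rho [v [v_gt0 Bv]]] :=
  positive_eigenvector main_block_ge0 main_block_irreducible comm.
have BvE i : \sum_j B i j * v j 0 = rho * v i 0.
  by have := congr1 (fun x : 'cV_n.+1 => x i 0) Bv; rewrite mxE => ->; rewrite mxE.
exists rho, (fun i => v i 0); split=> //; apply/andP; split.
  rewrite -(ltr_pM2r (v_gt0 ord0)) -BvE mul1r.
  apply: (@lt_le_trans _ _ (B ord0 ord0 * v ord0 0)).
    by rewrite ltr_pMl // mxE mxE /= muln0 add0n ltr1n binom_ge1_gt1.
  rewrite (bigD1 ord0) //= lerDl sumr_ge0 // => j _.
  by rewrite mulr_ge0 ?main_block_ge0 // ltW.
have [_] := lambdaP R (isT : 0 < m)%N; apply.
pose w : 'cV[R]_m := \col_i if unlift ord_max i is Some j then v j 0 else 0.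
have w_widen i : w (widen_ord (leqnSn _) i) 0 = v i 0.
  have -> : widen_ord (leqnSn _) i = lift ord_max i.
    by apply: val_inj; rewrite /= /bump leqNgt ltn_ord add0n.
  by rewrite mxE liftK.
have w_max : w ord_max 0 = 0 by rewrite mxE unlift_none.
apply: (@right_eigenvalue _ _ _ _ w).
  apply/eqP => w0; have := v_gt0 ord0.
  by rewrite -w_widen w0 mxE ltxx.
apply/colP => i; rewrite mxE [RHS]mxE big_ord_recr /= w_max mulr0 addr0.
case: (unliftP ord_max i) => [k ->|->].
  have -> : lift ord_max k = widen_ord (leqnSn _) k.
    by apply: val_inj; rewrite /= /bump leqNgt ltn_ord add0n.
  rewrite w_widen -BvE; apply: eq_bigr => j _.
  by rewrite w_widen [B k j]mxE.
rewrite w_max mulr0 big1 // => j _.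
rewrite Amat_last_row (_ : _ == _ = false) ?mul0r //.
by apply/negbTE; rewrite -val_eqE /= ltn_eqF.
Qed.

(* Adding [D * v j] on the left absorbs the contribution of the last column of
   [Amat], which has eigenvalue [1 < rho]; otherwise the induction would lose a
   constant at each step. *)
Lemma carry_count_le_block : exists C : R,
  forall t, (carry_count m t 0)%:R <= C * lambda R m ^+ t.
Proof.
have [rho [v [/andP[rho_gt1 rho_le] v_gt0 Bv]]] := main_block_eigenvector.
have [mu mu_gt0 mu_le] := ex_pos_lower_bound v_gt0.
pose b (j : 'I_n.+1) : R := Amat R m (widen_ord (leqnSn _) j) ord_max.
have b_ge0 j : 0 <= b j by rewrite /b mxE ler0n.
(* [D] is such that [b j <= D * (rho - 1) * v j]; the term [mu^-1] in [C] gives the case [t = 0]. *)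
pose D := (\sum_j b j) / ((rho - 1) * mu); pose C := D + mu^-1.
have rho1 : 0 < rho - 1 by rewrite subr_gt0.
have D_ge0 : 0 <= D by rewrite divr_ge0 ?sumr_ge0 // mulr_ge0 // ltW.
have bound t (j : 'I_n.+1) : (carry_count m t j)%:R + D * v j <= C * rho ^+ t * v j.
  elim: t j => [|t IH] j.
    by rewrite expr0 mulr1 /C mulrDl addrC lerD2l ler_pdivlMl // mulr1.
  have -> : (carry_count m t.+1 j)%:R =
      \sum_(c < n.+1) B j c * (carry_count m t c)%:R + b j.
    rewrite (carry_count_Amat R t (widen_ord (leqnSn _) j)) big_ord_recr /=.
    rewrite carry_count_last mulr1; congr (_ + _).
    by apply: eq_bigr => c _; rewrite [B j c]mxE.
  have b_le : b j <= D * (rho - 1) * v j.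
    apply: (@le_trans _ _ (D * (rho - 1) * mu)).
      rewrite /D -mulrA divfK ?gt_eqF ?mulr_gt0 //.
      by rewrite (bigD1 j) //= lerDl sumr_ge0.
    by rewrite ler_wpM2l // mulr_ge0 // ltW.
  have : \sum_(c < n.+1) B j c * ((carry_count m t c)%:R + D * v c) <=
         \sum_(c < n.+1) B j c * (C * rho ^+ t * v c).
    by apply: ler_sum => c _; rewrite ler_wpM2l ?main_block_ge0.
  have sumE (x : R) : \sum_(c < n.+1) B j c * (x * v c) = x * (rho * v j).
    by rewrite -Bv mulr_sumr; apply: eq_bigr => c _; rewrite mulrCA.
  under eq_bigr do rewrite mulrDr.
  rewrite big_split /= !sumE exprSr.
  set S := \sum_(c < _) _; lra.
exists (C * v ord0) => t; apply: (@le_trans _ _ (C * rho ^+ t * v ord0)).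
  apply: le_trans (bound t ord0); rewrite lerDl mulr_ge0 //; exact: ltW.
rewrite mulrAC ler_wpM2l ?lerXn2r ?nnegrE //.
- by rewrite mulr_ge0 ?addr_ge0 ?invr_ge0 // ltW.
- by rewrite (le_trans ler01) // ltW.
- by rewrite (le_trans ler01) // (le_trans (ltW rho_gt1)).
Qed.

End PerronAmat.

Lemma lambda_ge1 (R : realType) (m : nat) : (0 < m)%N -> 1 <= lambda R m.
Proof. by move=> m0; have [_] := lambdaP R m0; apply; apply: eigenvalue_Amat1. Qed.

Lemma carry_count_le (R : realType) (m : nat) : (0 < m)%N -> exists C : R,
  forall t, (carry_count m t 0)%:R <= C * lambda R m ^+ t.
Proof.
case: m => [//|[|n]] _; last exact: carry_count_le_block.
(* For [m = 1] the block would be empty: the last state is the only one. *)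
exists 1 => t; rewrite mul1r carry_count_last.
by rewrite exprn_ege1 // lambda_ge1.
Qed.

(** * Choice of parameters *)

Lemma absz_ceil_itv (R : realType) (x : R) : 0 <= x ->
  x <= `|Num.ceil x|%N%:R < x + 1.
Proof.
move=> x0; have c0 : (0 <= Num.ceil x)%R by rewrite ceil_ge0 (lt_le_trans _ x0) // ltrN10.
have -> : (`|Num.ceil x|%N)%:R = (Num.ceil x)%:~R :> R by rewrite pmulrn gez0_abs.
by have := ceil_itv x; rewrite intrB => /andP[]; rewrite ltrBlDr => -> ->.
Qed.

(** Serves the finitely many [l] with [low_width l >= l]: there the dimension is set to 1, and a
    single request is to be answered. *)
Lemma repetition_batch (F : finFieldType) (N : nat) : (0 < N)%N ->
  exists E : 'rV[F]_1 -> 'rV[F]_N, is_batch_code E 1.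
Proof.
case: N => // N _.
have E_det (x x' : 'rV[F]_1) (i : 'I_1) :
    (const_mx (x 0 0) : 'rV[F]_N.+1) ord0 ord0 = const_mx (x' 0 0) ord0 ord0 ->
    x ord0 i = x' ord0 i.
  by rewrite !mxE !ord1.
exists (fun x => const_mx (x 0 0)); apply: batch_of_determined => [x x' eqE|u].
  by apply/rowP => i; apply: E_det; rewrite eqE.
exists (fun=> [set: 'I_N.+1]%SET); split=> [i j|j x x' eqE].
  by rewrite !ord1.
by apply: E_det; apply: eqE; rewrite inE.
Qed.

Section Asymptotics.
Variables (R : realType) (m : nat) (eps : R).
Hypothesis m_gt0 : (0 < m)%N.
Let a : R := m%:R * eps - m%:R + 2.
Hypothesis a_ge0 : 0 <= a.
Hypothesis a_lt1 : a < 1.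

Definition low_width (l : nat) : nat := `|Num.ceil (l%:R * a)|%N.

Definition code_dim (l : nat) : nat :=
  if (low_width l < l)%N then #|good_set m (2 ^ l) (2 ^ low_width l)| else 1%N.

Lemma low_width_itv l : l%:R * a <= (low_width l)%:R < l%:R * a + 1.
Proof. by apply: absz_ceil_itv; rewrite mulr_ge0. Qed.

Lemma code_dim_gt0 l : (0 < code_dim l)%N.
Proof.
rewrite /code_dim; case: ifP => // sl; apply/card_gt0P.
have p0 : (0 < 2 ^ l)%N by rewrite expn_gt0.
exists [ffun=> Ordinal p0]; rewrite inE; apply: small_exponent_good.
rewrite big1 => [|i _]; last by rewrite ffunE.
by rewrite subn_gt0 ltn_exp2l.
Qed.

Lemma code_dim_le l : (code_dim l <= 2 ^ (m * l))%N.
Proof.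
rewrite /code_dim; case: ifP => _; last by rewrite expn_gt0.
by rewrite (leq_trans (max_card _)) // card_ffun !card_ord -expnM mulnC.
Qed.

Lemma natr_pow2 (n : nat) : (2 ^ n)%N%:R = 2 `^ n%:R :> R.
Proof. by rewrite natrX powR_mulrn. Qed.

Lemma powR2D (x y : R) : 2 `^ (x + y) = 2 `^ x * 2 `^ y.
Proof. by rewrite powRD // pnatr_eq0 implybT. Qed.

Lemma ler_powR2 (x y : R) : x <= y -> 2 `^ x <= 2 `^ y.
Proof. by apply: ler_powR; rewrite ler1n. Qed.

(** From [n <= q ^ m], the batch size [k] satisfies [k - 1 < n ^ eps <= q ^ (m * eps)], and
    [m * eps + 1 = a + m - 1], while [2 ^ low_width l >= q ^ a]. *)
Lemma batch_size_small l :
  (`|Num.ceil ((code_dim l)%:R `^ eps)|.-1 * 2 ^ l <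
   2 ^ low_width l * (2 ^ l) ^ m.-1)%N.
Proof.
set x := (code_dim l)%:R `^ eps; set k := `|Num.ceil x|%N.
have rhs_gt0 : (0 < 2 ^ low_width l * (2 ^ l) ^ m.-1)%N by rewrite muln_gt0 !expn_gt0.
have x_ge0 : 0 <= x by rewrite powR_ge0.
have /andP[_ k_lt] := absz_ceil_itv x_ge0; rewrite -/k in k_lt.
have [k_le1|k_gt1] := leqP k 1; first by rewrite (_ : k.-1 = 0)%N ?mul0n //; lia.
have k_ge2 : 2 <= k%:R :> R by rewrite ler_nat.
have x_gt1 : 1 < x by rewrite -(ltrD2r 1); apply: le_lt_trans k_lt.
have n_ge1 : 1 <= (code_dim l)%:R :> R by rewrite ler1n code_dim_gt0.
(* For [m = 1] the exponent [eps] is negative, but then [k <= 1], a case already settled. *)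
have eps_ge0 : 0 <= eps.
  rewrite leNgt; apply/negP => eps_lt0; move: x_gt1; apply/negP; rewrite -leNgt.
  by rewrite -(powRr0 (code_dim l)%:R); apply: ler_powR => //; apply: ltW.
have x_le : x <= 2 `^ ((m * l)%:R * eps).
  rewrite powRrM -natr_pow2; apply: ge0_ler_powR => //; rewrite ?nnegrE //.
  by rewrite ler_nat code_dim_le.
rewrite -(ltr_nat R) !natrM -expnM !natr_pow2.
apply: (@lt_le_trans _ _ (x * 2 `^ l%:R)).
  rewrite ltr_pM2r ?powR_gt0 // -(ltrD2r 1) natr1 prednK //; exact: ltnW.
apply: le_trans (ler_wpM2r (powR_ge0 _ _) x_le) _; rewrite -!powR2D; apply: ler_powR2.
have /andP[s_ge _] := low_width_itv l.
have -> : (l * m.-1)%:R = l%:R * (m%:R - 1) :> R by rewrite natrM -subn1 natrB.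
rewrite natrM; apply: le_trans (lerD s_ge (lexx _)).
by rewrite /a le_eqVlt; apply/orP; left; apply/eqP; ring.
Qed.

Lemma exists_batch_code l (F : finFieldType) : (0 < l)%N -> #|F| = (2 ^ l)%N ->
  exists E : 'rV[F]_(code_dim l) -> 'rV[F]_(#|F| ^ m),
    is_batch_code_real E ((code_dim l)%:R `^ eps).
Proof.
move=> l_gt0 cardF; rewrite /is_batch_code_real.
have := batch_size_small l; set k := `|Num.ceil _|%N => k_small.
have [sl|ls] := ltnP (low_width l) l.
  have -> : code_dim l = #|good_set m #|F| (2 ^ low_width l)|.
    by rewrite /code_dim sl cardF.
  apply: lifted_batch_code => //; last by rewrite cardF.
  exact: card_finPcharP cardF _.
have nE : code_dim l = 1%N by rewrite /code_dim ltnNge ls.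
have -> : k = 1%N by rewrite /k nE powR1 ceil1.
rewrite nE; apply: repetition_batch.
by rewrite cardF !expn_gt0.
Qed.

Lemma redundancy_le (C : R) l : (low_width l < l)%N ->
  (forall t, (carry_count m t 0)%:R <= C * lambda R m ^+ t) ->
  ((2 ^ l) ^ m)%N%:R - (code_dim l)%:R <=
  C * 2 `^ ((m * low_width l)%:R + log2 (lambda R m) * (l - low_width l)%N%:R) :> R.
Proof.
move=> sl count_le; set s := low_width l in sl *.
have lE : (l = s + (l - s))%N by rewrite subnKC // ltnW.
have lambda_gt0 : 0 < lambda R m by rewrite (lt_le_trans ltr01) // lambda_ge1.
have lambdaE : lambda R m = 2 `^ log2 (lambda R m).
  rewrite /powR pnatr_eq0 /= /log2 divfK ?lnK //.
  by rewrite gt_eqF // ln_gt0 // ltr1n.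
have card_all : ((2 ^ l) ^ m = #|good_set m (2 ^ l) (2 ^ s)| +
    #|[set d : {ffun 'I_m -> 'I_(2 ^ l)} | ~~ good_exponent (2 ^ s) d]%SET|)%N.
  have <- : #|{ffun 'I_m -> 'I_(2 ^ l)}| = ((2 ^ l) ^ m)%N by rewrite card_ffun !card_ord.
  rewrite -(cardC [in good_set m (2 ^ l) (2 ^ s)]); congr addn.
  by apply: eq_card => d; rewrite !inE.
rewrite /code_dim sl -/s card_all natrD addrC addKr.
have := card_bad_exponent m s (t := l - s); rewrite -lE subn_gt0 => /(_ sl).
rewrite -(ler_nat R) natrM => /le_trans; apply.
rewrite powR2D powRrM -lambdaE natr_pow2.
rewrite [lambda R m `^ _]powR_mulrn ?(ltW lambda_gt0) // mulrCA.
by rewrite ler_wpM2l ?powR_ge0.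
Qed.

(** The redundancy is at most a constant times [q ^ e]. As [n] is at least a constant times [q ^ m]
    and the claimed exponent [E0] satisfies [m * E0 = e], [n ^ E0] is at least a constant times
    [q ^ e]; this uses [E0 >= 0]. *)
Lemma redundancy_bigO :
  (fun l : nat => (((2 ^ l) ^ m)%N%:R - (code_dim l)%:R : R)) =O_\oo
  (fun l : nat =>
     (code_dim l)%:R `^ ((m%:R - log2 (lambda R m)) * eps
        + ((m%:R - 1) * log2 (lambda R m) / m%:R - m%:R + 2))).
Proof.
set L := log2 (lambda R m).
pose E0 : R := (m%:R - L) * eps + ((m%:R - 1) * L / m%:R - m%:R + 2).
have [C count_le] := carry_count_le R m_gt0.
have m0 : m%:R != 0 :> R by rewrite pnatr_eq0 -lt0n.
have L_ge0 : 0 <= L.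
  by rewrite /L /log2 divr_ge0 // ln_ge0 ?ler1n // lambda_ge1.
pose e := L + a * (m%:R - L).
have E0e : m%:R * E0 = e by rewrite /E0 /e /a; field.
have e_ge0 : 0 <= e.
  have -> : e = L * (1 - a) + a * m%:R by rewrite /e; ring.
  by rewrite addr_ge0 // mulr_ge0 // subr_ge0 ltW.
have E0_ge0 : 0 <= E0 by rewrite -(pmulr_rge0 _ (x := m%:R)) ?E0e // ltr0n.
pose C' := Num.max C 1; have C'_gt0 : 0 < C' by rewrite lt_max ltr01 orbT.
(* [C'] replaces [C], which might not be positive. The exponent term [|m - L|] pays for rounding
   [l * a] up to [s], and [m * e] for the loss in [n >= 2 ^ (m * (l - m))]. *)
apply/eqO_exP; exists (C' * 2 `^ (`|m%:R - L| + m%:R * e)).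
  by rewrite mulr_gt0 // powR_gt0.
near=> l; rewrite -/E0.
have m_le : (m <= l)%N by near: l; exact: nbhs_infty_ge.
(* This gives [l * a + 1 <= l], hence [s < l]: the repetition code no longer occurs. *)
have l_ge : (1 - a)^-1 <= l%:R by near: l; exact: nbhs_infty_ger.
have /andP[s_ge s_lt] := low_width_itv l; set s := low_width l in s_ge s_lt.
have sl : (s < l)%N.
  rewrite -(ltr_nat R); apply: lt_le_trans s_lt _.
  have a1 : 0 < 1 - a by rewrite subr_gt0.
  by move: l_ge; rewrite -[_^-1]mul1r ler_pdivrMr //; lra.
rewrite [X in X <= _]ger0_norm; last by rewrite subr_ge0 ler_nat -expnM mulnC code_dim_le.
rewrite [`|_ `^ _|]ger0_norm ?powR_ge0 //.
have dim_ge : 2 `^ ((l%:R - m%:R) * e) <= (code_dim l)%:R `^ E0.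
  have -> : (l%:R - m%:R) * e = (m * (l - m))%N%:R * E0.
    by rewrite natrM natrB // -E0e; ring.
  rewrite powRrM -natr_pow2; apply: ge0_ler_powR => //; rewrite ?nnegrE // ler_nat.
  by rewrite /code_dim sl card_good_exponent_ge ?m_gt0.
apply: le_trans (redundancy_le sl count_le) _; rewrite -/L -/s -[leRHS]mulrA.
apply: (@le_trans _ _ (C' * 2 `^ ((m * s)%:R + L * (l - s)%N%:R))).
  by rewrite ler_wpM2r ?powR_ge0 // le_max lexx.
rewrite ler_pM2l //; apply: le_trans (ler_wpM2l (powR_ge0 _ _) dim_ge).
rewrite -powR2D; apply: ler_powR2; rewrite natrM natrB ?(ltnW sl) //.
have -> : m%:R * s%:R + L * (l%:R - s%:R) =
    (m%:R - L) * (s%:R - l%:R * a) + l%:R * e by rewrite /e; ring.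
have -> : `|m%:R - L| + m%:R * e + (l%:R - m%:R) * e = `|m%:R - L| + l%:R * e by ring.
rewrite lerD2r; apply: le_trans (ler_norm _) _; rewrite normrM ler_piMr //.
by rewrite ger0_norm ?subr_ge0 // lerBlDl addrC ltW // addrC.
Unshelve. all: by end_near.
Qed.

End Asymptotics.

Unset Implicit Arguments.

Theorem theorem3 (R : realType) (m : nat) (eps : R)
    (m_gt0 : (0 < m)%N)
    (eps_ge : (m%:R - 2) / m%:R <= eps)
    (eps_lt : eps < (m%:R - 1) / m%:R) :
  exists n : nat -> nat,
    (forall l : nat, (0 < l)%N ->
       (0 < n l)%N /\
       forall F : finFieldType, #|F| = (2 ^ l)%N ->
         exists E : 'rV[F]_(n l) -> 'rV[F]_(#|F| ^ m),
           is_batch_code_real E ((n l)%:R `^ eps)) /\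
    (fun l : nat => (((2 ^ l) ^ m)%N%:R - (n l)%:R : R)) =O_\oo
    (fun l : nat =>
       (n l)%:R `^ ((m%:R - log2 (lambda R m)) * eps
                    + ((m%:R - 1) * log2 (lambda R m) / m%:R - m%:R + 2))).
Proof.
have m0 : 0 < m%:R :> R by rewrite ltr0n.
have a_ge0 : 0 <= m%:R * eps - m%:R + 2.
  by move: eps_ge; rewrite ler_pdivrMr // mulrC; lra.
have a_lt1 : m%:R * eps - m%:R + 2 < 1.
  by move: eps_lt; rewrite ltr_pdivlMr // mulrC; lra.
exists (code_dim m eps); split=> [l l_gt0|]; last exact: redundancy_bigO.
split=> [|F cardF]; first exact: code_dim_gt0.
exact: exists_batch_code.
Qed.
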